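(* Let $R$ be a ring. Then the functor $\mathrm{twist}_R : \mathrm{Grp}/\mathrm{Aut}_{\mathrm{Ring}}(R) \to R/\mathrm{Ring}$, which sends a group homomorphism $\theta: G \to \mathrm{Aut}_{\mathrm{Ring}}(R)$ to its twisted group ring $R \to R_\theta[G]$, is left adjoint to the functor $\mathrm{semi}_R : R/\mathrm{Ring} \to \mathrm{Grp}/\mathrm{Aut}_{\mathrm{Ring}}(R)$, which sends a ring homomorphism $f: R \to S$ to the group $\mathrm{semi}_R(S)$ of semilinear inner automorphisms under $R$, with its forgetful homomorphism to $\mathrm{Aut}_{\mathrm{Ring}}(R)$.
   Context: Rings are associative and unital, not necessarily commutative, and ring homomorphisms are unital. $\mathrm{Aut}_{\mathrm{Ring}}(R)$ is the group of ring automorphisms of $R$ under composition. Categories. $\mathrm{Grp}/\mathrm{Aut}_{\mathrm{Ring}}(R)$ is the slice category: objects are group homomorphisms $\theta: G\to \mathrm{Aut}_{\mathrm{Ring}}(R)$, and a morphism from $\theta: G\to \mathrm{Aut}_{\mathrm{Ring}}(R)$ to $\psi: K \to \mathrm{Aut}_{\mathrm{Ring}}(R)$ is a group homomorphism $j: G\to K$ with $\psi\circ j=\theta$. $R/\mathrm{Ring}$ is the category of rings under $R$: objects are ring homomorphisms $f: R\to S$, and a morphism from $f: R\to S$ to $g: R\to T$ is a ring homomorphism $h: S\to T$ with $h\circ f = g$. Write $\theta_g$ for $\theta(g)$. Twisted group ring. For $\theta: G\to \mathrm{Aut}_{\mathrm{Ring}}(R)$, the ring $R_\theta[G]$ has the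 same elements and addition as the group ring $R[G]$ (finite formal sums of terms $rg$ with $r\in R$, $g\in G$), with multiplication the additive extension of $(r_1g_1)\cdot(r_2g_2) := r_1\theta_{g_1}(r_2)\,g_1g_2$. It is an object of $R/\mathrm{Ring}$ via $r\mapsto r1_G$. On a morphism $j$ from $\theta: G\to \mathrm{Aut}_{\mathrm{Ring}}(R)$ to $\psi: K\to \mathrm{Aut}_{\mathrm{Ring}}(R)$, $\mathrm{twist}_R(j): R_\theta[G]\to R_\psi[K]$ is the additive map with $rg\mapsto r\,j(g)$. Semilinearization. For a ring homomorphism $f: R\to S$, $$\mathrm{semi}_R(S) := \{(s,\phi)\in S^\times\times \mathrm{Aut}_{\mathrm{Ring}}(R) \mid s f(r) = f(\phi(r)) s \text{ for each } r\in R\},$$ a group under $(s,\phi)\cdot(s',\psi) := (ss',\phi\psi)$, with forgetful group homomorphism $\mathrm{semi}_R(S)\to\mathrm{Aut}_{\mathrm{Ring}}(R)$, $(s,\phi)\mapsto\phi$. On a morphism $h: S\to T$ in $R/\mathrm{Ring}$, $\mathrm{semi}_R(h)(s,\phi) := (h(s),\phi)$. *)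

(* Defs.v *)
(* MathComp, with classical axioms from mathcomp-classical and the type
   {malg R[G]} of finitely supported functions G -> R from multinomials.
   Groups are [groupType]s and rings are [pzRingType]s, so the zero ring is
   allowed. *)
From HB Require Import structures.
From mathcomp Require Import all_boot all_order all_algebra.
From mathcomp Require Import boolp finmap monalg.

Set Implicit Arguments.
Unset Strict Implicit.
Unset Printing Implicit Defensive.

Import GRing.Theory.

Local Open Scope ring_scope.

Section Categories.

Record category := Category {
  obj :> Type;
  mor : obj -> obj -> Type;
  idc : forall A, mor A A;
  compc : forall A B C, mor B C -> mor A B -> mor A C;
  compc1 : forall A B (f : mor A B), compc f (idc A) = f;
  comp1c : forall A B (f : mor A B), compc (idc B) f = f;
  compcA : forall A B C D (h : mor C D) (g : mor B C) (f : mor A B),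
    compc h (compc g f) = compc (compc h g) f
}.

Record functor (C D : category) := Functor {
  fobj :> C -> D;
  fhom : forall A B : C, mor A B -> mor (fobj A) (fobj B);
  fhom1 : forall A : C, fhom (idc A) = idc (fobj A);
  fhomM : forall (X Y Z : C) (g : mor Y Z) (f : mor X Y),
    fhom (compc g f) = compc (fhom g) (fhom f)
}.

End Categories.

Arguments mor {c} A B : rename.
Arguments idc {c} A : rename.
Arguments compc {c A B C} g f : rename.
Arguments fhom {C D} F {A B} f : rename.

Declare Scope cat_scope.
Delimit Scope cat_scope with cat.
Notation "g \c f" := (compc g f)
  (at level 40, left associativity) : cat_scope.

(* F is left adjoint to G: there are bijections Hom(F A, B) -> Hom(A, G B),
   natural in A and B. *)
Definition left_adjoint (C D : category) (F : functor C D) (G : functor D C)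
  : Prop :=
  exists Phi : forall (A : C) (B : D), mor (F A) B -> mor A (G B),
    (forall A B, bijective (@Phi A B)) /\
    (forall (A A' : C) (B B' : D)
       (a : mor A' A) (b : mor B B') (h : mor (F A) B),
       Phi A' B' (b \c h \c fhom F a)%cat = (fhom G b \c Phi A B h \c a)%cat).

Section Slice.
Variables (C : category) (X : C).
Local Open Scope cat_scope.

Record slice_obj := SliceObj { slice_dom : C; slice_map : mor slice_dom X }.

Definition slice_hom (A B : slice_obj) :=
  {j : mor (slice_dom A) (slice_dom B) | slice_map B \c j = slice_map A}.

Lemma slice_hom_eq A B (u v : slice_hom A B) : sval u = sval v -> u = v.
Proof. by case: u v => [u pu] [v pv] /=; exact: eq_exist. Qed.

Fact slice_id_subproof A : slice_map A \c idc (slice_dom A) = slice_map A.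
Proof. exact: compc1. Qed.

Fact slice_comp_subproof A B D (v : slice_hom B D) (u : slice_hom A B) :
  slice_map D \c (sval v \c sval u) = slice_map A.
Proof. by rewrite compcA (svalP v) (svalP u). Qed.

Definition slice_id A : slice_hom A A := exist _ _ (slice_id_subproof A).
Definition slice_comp A B D (v : slice_hom B D) (u : slice_hom A B) :
  slice_hom A D := exist _ _ (slice_comp_subproof v u).

Fact slice_comp1 A B (u : slice_hom A B) : slice_comp u (slice_id A) = u.
Proof. by apply: slice_hom_eq; exact: compc1. Qed.
Fact slice_1comp A B (u : slice_hom A B) : slice_comp (slice_id B) u = u.
Proof. by apply: slice_hom_eq; exact: comp1c. Qed.
Fact slice_compA A B D E (w : slice_hom D E) (v : slice_hom B D)
    (u : slice_hom A B) :
  slice_comp w (slice_comp v u) = slice_comp (slice_comp w v) u.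
Proof. by apply: slice_hom_eq; exact: compcA. Qed.

Definition slice : category :=
  Category slice_comp1 slice_1comp slice_compA.

End Slice.

Section Coslice.
Variables (C : category) (X : C).
Local Open Scope cat_scope.

Record coslice_obj :=
  CosliceObj { coslice_cod : C; coslice_map : mor X coslice_cod }.

Definition coslice_hom (A B : coslice_obj) :=
  {h : mor (coslice_cod A) (coslice_cod B) |
    h \c coslice_map A = coslice_map B}.

Lemma coslice_hom_eq A B (u v : coslice_hom A B) : sval u = sval v -> u = v.
Proof. by case: u v => [u pu] [v pv] /=; exact: eq_exist. Qed.

Fact coslice_id_subproof A :
  idc (coslice_cod A) \c coslice_map A = coslice_map A.
Proof. exact: comp1c. Qed.

Fact coslice_comp_subproof A B D (v : coslice_hom B D) (u : coslice_hom A B) :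
  sval v \c sval u \c coslice_map A = coslice_map D.
Proof. by rewrite -compcA (svalP u) (svalP v). Qed.

Definition coslice_id A : coslice_hom A A := exist _ _ (coslice_id_subproof A).
Definition coslice_comp A B D (v : coslice_hom B D) (u : coslice_hom A B) :
  coslice_hom A D := exist _ _ (coslice_comp_subproof v u).

Fact coslice_comp1 A B (u : coslice_hom A B) :
  coslice_comp u (coslice_id A) = u.
Proof. by apply: coslice_hom_eq; exact: compc1. Qed.
Fact coslice_1comp A B (u : coslice_hom A B) :
  coslice_comp (coslice_id B) u = u.
Proof. by apply: coslice_hom_eq; exact: comp1c. Qed.
Fact coslice_compA A B D E (w : coslice_hom D E) (v : coslice_hom B D)
    (u : coslice_hom A B) :
  coslice_comp w (coslice_comp v u) = coslice_comp (coslice_comp w v) u.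
Proof. by apply: coslice_hom_eq; exact: compcA. Qed.

Definition coslice : category :=
  Category coslice_comp1 coslice_1comp coslice_compA.

End Coslice.

Notation "{ 'grphom' G -> H }" := (UMagmaMorphism.type G%type H%type)
  (at level 0, G at level 98, H at level 99,
   format "{ 'grphom'  G  ->  H }") : type_scope.

Lemma grphomP (G H : groupType) (u v : {grphom G -> H}) : u =1 v -> u = v.
Proof.
case: u v => [u [[u1] [uM]]] [v [[v1] [vM]]] /= /funext uv.
case: _ / uv in v1 vM *.
by rewrite (Prop_irrelevance v1 u1) (Prop_irrelevance vM uM).
Qed.

Lemma rmorphP (S T : pzRingType) (u v : {rmorphism S -> T}) : u =1 v -> u = v.
Proof.
case: u v => [u [[ua] [um]]] [v [[va] [vm]]] /= /funext uv.
case: _ / uv in va vm *.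
by rewrite (Prop_irrelevance va ua) (Prop_irrelevance vm um).
Qed.

Section GrpCategory.

Definition grp_id (G : groupType) : {grphom G -> G} := idfun.
Definition grp_comp (G H K : groupType)
  (v : {grphom H -> K}) (u : {grphom G -> H}) : {grphom G -> K} := v \o u.

Fact grp_comp1 (G H : groupType) (u : {grphom G -> H}) :
  grp_comp u (grp_id G) = u.
Proof. exact: grphomP. Qed.
Fact grp_1comp (G H : groupType) (u : {grphom G -> H}) :
  grp_comp (grp_id H) u = u.
Proof. exact: grphomP. Qed.
Fact grp_compA (G H K L : groupType) (w : {grphom K -> L})
    (v : {grphom H -> K}) (u : {grphom G -> H}) :
  grp_comp w (grp_comp v u) = grp_comp (grp_comp w v) u.
Proof. exact: grphomP. Qed.

Definition Grp : category := Category grp_comp1 grp_1comp grp_compA.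

End GrpCategory.

Section RingCategory.

Definition ring_id (S : pzRingType) : {rmorphism S -> S} := idfun.
Definition ring_comp (S T U : pzRingType)
  (v : {rmorphism T -> U}) (u : {rmorphism S -> T}) : {rmorphism S -> U} :=
  v \o u.

Fact ring_comp1 (S T : pzRingType) (u : {rmorphism S -> T}) :
  ring_comp u (ring_id S) = u.
Proof. exact: rmorphP. Qed.
Fact ring_1comp (S T : pzRingType) (u : {rmorphism S -> T}) :
  ring_comp (ring_id T) u = u.
Proof. exact: rmorphP. Qed.
Fact ring_compA (S T U V : pzRingType) (w : {rmorphism U -> V})
    (v : {rmorphism T -> U}) (u : {rmorphism S -> T}) :
  ring_comp w (ring_comp v u) = ring_comp (ring_comp w v) u.
Proof. exact: rmorphP. Qed.

Definition Ring : category := Category ring_comp1 ring_1comp ring_compA.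

End RingCategory.

Record ring_aut (R : pzRingType) := RingAut {
  aut_fun :> {rmorphism R -> R};
  aut_bij : bijective aut_fun
}.

Section RingAutGroup.
Variable R : pzRingType.
Implicit Types a b c : ring_aut R.

Lemma ring_autP a b : a =1 b -> a = b.
Proof.
case: a b => [a abij] [b bbij] /= /rmorphP ab.
by case: _ / ab in bbij *; rewrite (Prop_irrelevance abij bbij).
Qed.

HB.instance Definition _ := gen_eqMixin (ring_aut R).
HB.instance Definition _ := gen_choiceMixin (ring_aut R).

Definition aut_one := @RingAut R idfun (Bijective (frefl _) (frefl _)).
Definition aut_mul a b := @RingAut R (a \o b) (bij_comp (aut_bij a) (aut_bij b)).

Fact aut_inv_subproof a : exists b, cancel a b /\ cancel b a.
Proof.
have [g ag ga] := aut_bij a.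
have gB : zmod_morphism g by apply: can2_zmod_morphism ag ga.
have gM : GRing.monoid_morphism g by apply: can2_monoid_morphism ag ga.
pose gA := GRing.isZmodMorphism.Build R R g gB.
pose gm := GRing.isMonoidMorphism.Build R R g gM.
pose gR : {rmorphism R -> R} := HB.pack g gA gm.
by exists (@RingAut R gR (Bijective ga ag)).
Qed.

Definition aut_inv a := sval (cid (aut_inv_subproof a)).

Fact aut_mulA : associative aut_mul.
Proof. by move=> a b c; exact: ring_autP. Qed.
Fact aut_mul1 : left_id aut_one aut_mul.
Proof. by move=> a; exact: ring_autP. Qed.
Fact aut_1mul : right_id aut_one aut_mul.
Proof. by move=> a; exact: ring_autP. Qed.
Fact aut_mulV : left_inverse aut_one aut_inv aut_mul.
Proof.
move=> a; apply: ring_autP => x /=.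
by rewrite /aut_inv; case: cid => b /= [ab ba]; exact: ab.
Qed.
Fact aut_Vmul : right_inverse aut_one aut_inv aut_mul.
Proof.
move=> a; apply: ring_autP => x /=.
by rewrite /aut_inv; case: cid => b /= [ab ba]; exact: ba.
Qed.

HB.instance Definition _ := isGroup.Build (ring_aut R)
  aut_mulA aut_mul1 aut_1mul aut_mulV aut_Vmul.

Lemma ring_aut1E x : (1%g : ring_aut R) x = x.
Proof. by []. Qed.
Lemma ring_autME a b x : (a * b)%g x = a (b x).
Proof. by []. Qed.

End RingAutGroup.

Notation GrpOver R := (@slice Grp (ring_aut R : groupType)).
Notation RingUnder R := (@coslice Ring R).

(* The additive extension of k |-> E k, for E k : M -> V additive. *)
Section AdditiveExtension.
Variables (K : choiceType) (M V : zmodType) (E : K -> {additive M -> V}).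

Definition malg_ext (x : {malg M[K]}) : V := \sum_(k <- msupp x) E k x@_k.

Lemma malg_extEw (D : {fset K}) (x : {malg M[K]}) :
  (msupp x `<=` D)%fset -> malg_ext x = \sum_(k <- D) E k x@_k.
Proof.
move=> xD; rewrite /malg_ext (big_fset_incl _ xD) // => k _ kx.
by rewrite mcoeff_outdom // raddf0.
Qed.

Lemma malg_extU k m : malg_ext << m *g k >> = E k m.
Proof.
by rewrite (malg_extEw msuppU_le) big_seq_fset1 mcoeffUU.
Qed.

Fact malg_ext_zmod_morphism : zmod_morphism malg_ext.
Proof.
move=> x y; pose D := (msupp x `|` msupp y)%fset.
rewrite (@malg_extEw D x) ?fsubsetUl // (@malg_extEw D y) ?fsubsetUr //.
rewrite (@malg_extEw D (x - y)) ?msuppB_le // -sumrB.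
by apply: eq_bigr => k _; rewrite mcoeffB raddfB.
Qed.

HB.instance Definition _ :=
  GRing.isZmodMorphism.Build {malg M[K]} V malg_ext malg_ext_zmod_morphism.

End AdditiveExtension.

Lemma malg_ind (K : choiceType) (M : zmodType) (P : {malg M[K]} -> Prop) :
  P 0 -> (forall x y, P x -> P y -> P (x + y)) ->
  (forall k m, P << m *g k >>) -> forall x, P x.
Proof.
by move=> P0 PD PU x; rewrite [x]monalgE; apply: big_ind => // k _; exact: PU.
Qed.

Section TwistedGroupRing.
Variables (R : pzRingType) (G : groupType) (theta : {grphom G -> ring_aut R}).

(* x@_g is the coefficient of g in x, and << r *g g >> is the term r g. *)
Definition twisted_ring of {grphom G -> ring_aut R} : Type := {malg R[G]}.

Local Notation twr := (twisted_ring theta).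

HB.instance Definition _ := GRing.Zmodule.copy twr {malg R[G]}.

Implicit Types x y z : {malg R[G]}.

Definition tw_one : {malg R[G]} := << 1 *g 1%g >>.

Definition tw_mul x y : {malg R[G]} :=
  \sum_(g <- msupp x) \sum_(h <- msupp y)
    << x@_g * theta g y@_h *g (g * h)%g >>.

Lemma tw_mulEw (D E : {fset G}) x y :
  (msupp x `<=` D)%fset -> (msupp y `<=` E)%fset ->
  tw_mul x y =
    \sum_(g <- D) \sum_(h <- E) << x@_g * theta g y@_h *g (g * h)%g >>.
Proof.
move=> xD yE; rewrite /tw_mul (big_fset_incl _ xD) => [|g _ gx].
  apply: eq_bigr => g _; rewrite (big_fset_incl _ yE) // => h _ hy.
  by rewrite (mcoeff_outdom hy) rmorph0 mulr0 raddf0.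
by rewrite big1 // => h _; rewrite (mcoeff_outdom gx) mul0r raddf0.
Qed.

Fact tw_mulDl : left_distributive tw_mul +%R.
Proof.
move=> x y z; pose D := (msupp x `|` msupp y)%fset.
rewrite (@tw_mulEw D (msupp z)) ?msuppD_le //.
rewrite (@tw_mulEw D (msupp z) x) ?fsubsetUl //.
rewrite (@tw_mulEw D (msupp z) y) ?fsubsetUr // -big_split /=.
apply: eq_bigr => g _; rewrite -big_split /=; apply: eq_bigr => h _.
by rewrite mcoeffD mulrDl raddfD.
Qed.

Fact tw_mulDr : right_distributive tw_mul +%R.
Proof.
move=> x y z; pose D := (msupp y `|` msupp z)%fset.
rewrite (@tw_mulEw (msupp x) D) ?msuppD_le //.
rewrite (@tw_mulEw (msupp x) D x y) ?fsubsetUl //.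
rewrite (@tw_mulEw (msupp x) D x z) ?fsubsetUr // -big_split /=.
apply: eq_bigr => g _; rewrite -big_split /=; apply: eq_bigr => h _.
by rewrite mcoeffD rmorphD mulrDr raddfD.
Qed.

Lemma tw_mul0l x : tw_mul 0 x = 0.
Proof. by rewrite /tw_mul msupp0 big_seq_fset0. Qed.

Lemma tw_mul0r x : tw_mul x 0 = 0.
Proof.
by rewrite /tw_mul big1 // => g _; rewrite msupp0 big_seq_fset0.
Qed.

Lemma tw_mulU r s g h :
  tw_mul << r *g g >> << s *g h >> = << r * theta g s *g (g * h)%g >>.
Proof.
rewrite (@tw_mulEw [fset g]%fset [fset h]%fset) ?msuppU_le //.
by rewrite !big_seq_fset1 !mcoeffUU.
Qed.

Fact tw_mulA : associative tw_mul.
Proof.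
move=> x y z; elim/malg_ind: x => [|x x' IHx IHx'|g r].
- by rewrite !tw_mul0l.
- by rewrite !tw_mulDl IHx IHx'.
elim/malg_ind: y => [|y y' IHy IHy'|h s].
- by rewrite !(tw_mul0l, tw_mul0r).
- by rewrite !(tw_mulDl, tw_mulDr) IHy IHy'.
elim/malg_ind: z => [|z z' IHz IHz'|k t].
- by rewrite !tw_mul0r.
- by rewrite !tw_mulDr IHz IHz'.
by rewrite !tw_mulU rmorphM mulrA mulgA gmulfM.
Qed.

Fact tw_mul1l : left_id tw_one tw_mul.
Proof.
elim/malg_ind => [|x y IHx IHy|g r]; first exact: tw_mul0r.
  by rewrite tw_mulDr IHx IHy.
by rewrite tw_mulU mul1r mul1g gmulf1.
Qed.

Fact tw_mul1r : right_id tw_one tw_mul.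
Proof.
elim/malg_ind => [|x y IHx IHy|g r]; first exact: tw_mul0l.
  by rewrite tw_mulDl IHx IHy.
by rewrite tw_mulU rmorph1 mulr1 mulg1.
Qed.

HB.instance Definition _ := GRing.Zmodule_isPzRing.Build twr
  tw_mulA tw_mul1l tw_mul1r tw_mulDl tw_mulDr.

Definition tw_incl (r : R) : twr := << r *g 1%g >>.

Fact tw_incl_zmod_morphism : zmod_morphism tw_incl.
Proof. exact: monalgU_is_additive. Qed.

Fact tw_incl_monoid_morphism : GRing.monoid_morphism tw_incl.
Proof.
split=> // r s; apply: esym.
by rewrite [LHS]tw_mulU mulg1 gmulf1.
Qed.

HB.instance Definition _ :=
  GRing.isZmodMorphism.Build R twr tw_incl tw_incl_zmod_morphism.
HB.instance Definition _ :=
  GRing.isMonoidMorphism.Build R twr tw_incl tw_incl_monoid_morphism.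

Lemma tw_ind (P : twr -> Prop) :
  P 0 -> (forall x y : twr, P x -> P y -> P (x + y)) ->
  (forall g r, P << r *g g >>) -> forall x, P x.
Proof. exact: malg_ind. Qed.

End TwistedGroupRing.

Section TwistFunctor.
Variable R : pzRingType.

Section Map.
Variables (A B : GrpOver R) (j : mor A B).

Local Notation domr := (twisted_ring (slice_map A)).
Local Notation codr := (twisted_ring (slice_map B)).
Local Notation jmap :=
  (sval j : {grphom slice_dom A -> slice_dom B}).

Definition tw_map (x : domr) : codr :=
  malg_ext (fun g => @mkmalgU _ R (jmap g)) x.

Lemma tw_mapU r g : tw_map << r *g g >> = << r *g jmap g >>.
Proof. exact: malg_extU. Qed.

Fact tw_map_zmod_morphism : zmod_morphism tw_map.
Proof. exact: malg_ext_zmod_morphism. Qed.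

Lemma tw_map_theta g :
  (slice_map B : {grphom _ -> ring_aut R}) (jmap g) =
  (slice_map A : {grphom _ -> ring_aut R}) g.
Proof. by rewrite -[in RHS](svalP j). Qed.

HB.instance Definition _ :=
  GRing.isZmodMorphism.Build domr codr tw_map tw_map_zmod_morphism.

Lemma tw_map0 : tw_map 0 = 0.
Proof. exact: raddf0. Qed.

Lemma tw_mapD : {morph tw_map : x y / x + y}.
Proof. exact: raddfD. Qed.

Fact tw_map_monoid_morphism : GRing.monoid_morphism tw_map.
Proof.
split=> [|x y]; first by rewrite [LHS]tw_mapU gmulf1.
elim/tw_ind: x => [|x x' IHx IHx'|g r].
- by rewrite mul0r tw_map0 mul0r.
- by rewrite mulrDl !tw_mapD IHx IHx' -mulrDl.
elim/tw_ind: y => [|y y' IHy IHy'|h s].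
- by rewrite mulr0 tw_map0 mulr0.
- by rewrite mulrDr !tw_mapD IHy IHy' -mulrDr.
rewrite !tw_mapU.
rewrite [X in tw_map X]tw_mulU [RHS]tw_mulU tw_mapU tw_map_theta.
by rewrite gmulfM.
Qed.

HB.instance Definition _ :=
  GRing.isMonoidMorphism.Build domr codr tw_map tw_map_monoid_morphism.

End Map.

Definition twist_obj (A : GrpOver R) : RingUnder R :=
  @CosliceObj Ring R (twisted_ring (slice_map A) : pzRingType)
    (@tw_incl R (slice_dom A) (slice_map A) : {rmorphism _ -> _}).

Definition twist_hom (A B : GrpOver R) (j : mor A B) :
  mor (twist_obj A) (twist_obj B).
Proof.
exists (tw_map j : {rmorphism _ -> _}).
by apply: rmorphP => r /=; rewrite [LHS]tw_mapU gmulf1.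
Defined.

Fact twist_hom1 (A : GrpOver R) : twist_hom (idc A) = idc (twist_obj A).
Proof.
apply: coslice_hom_eq; apply: rmorphP => x /=.
elim/tw_ind: x => [|x y IHx IHy|g r]; 
  rewrite ?tw_map0 ?tw_mapD ?IHx ?IHy //.
exact: tw_mapU.
Qed.

Fact twist_homM (A B D : GrpOver R) (v : mor B D) (u : mor A B) :
  twist_hom (compc v u) = compc (twist_hom v) (twist_hom u).
Proof.
apply: coslice_hom_eq; apply: rmorphP => x /=.
elim/tw_ind: x => [|x y IHx IHy|g r]; 
  rewrite ?tw_map0 ?tw_mapD ?IHx ?IHy //.
by rewrite !tw_mapU.
Qed.

Definition twist : functor (GrpOver R) (RingUnder R) :=
  Functor twist_hom1 twist_homM.

End TwistFunctor.

Definition invertible (S : pzRingType) (s : S) :=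
  exists t : S, t * s = 1 /\ s * t = 1.

Section Semilinearization.
Variables (R S : pzRingType) (f : {rmorphism R -> S}).

Record semilin := Semilin {
  semi_val : S;
  semi_aut : ring_aut R;
  semi_unit : invertible semi_val;
  semi_comm : forall r : R, semi_val * f r = f (semi_aut r) * semi_val
}.

Lemma semilinP (p q : semilin) :
  semi_val p = semi_val q -> semi_aut p = semi_aut q -> p = q.
Proof.
case: p q => [s a su sc] [t b tu tc] /= st ab.
case: _ / st in tu tc *; case: _ / ab in tc *.
by rewrite (Prop_irrelevance tu su) (Prop_irrelevance tc sc).
Qed.

HB.instance Definition _ := gen_eqMixin semilin.
HB.instance Definition _ := gen_choiceMixin semilin.

Definition semi_one : semilin.
Proof.
exists 1 1%g; first by exists 1; rewrite mul1r.
by move=> r; rewrite mul1r mulr1.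
Defined.

Definition semi_mul (p q : semilin) : semilin.
Proof.
exists (semi_val p * semi_val q) (semi_aut p * semi_aut q)%g.
- have [[s [sp ps]] [t [tq qt]]] := (semi_unit p, semi_unit q).
  exists (t * s).
  by rewrite mulrA -(mulrA t) sp mulr1 tq mulrA -(mulrA _ _ t) qt mulr1 ps.
- by move=> r; rewrite -mulrA semi_comm mulrA semi_comm mulrA.
Defined.

Fact semi_inv_subproof (p : semilin) :
  exists q, semi_mul q p = semi_one /\ semi_mul p q = semi_one.
Proof.
have [s [sp ps]] := semi_unit p.
have su : invertible s by exists (semi_val p).
have sc r : s * f r = f ((semi_aut p)^-1%g r) * s.
  rewrite -[LHS]mulr1 -ps mulrA -(mulrA s) -{1}[r](ring_aut1E r).
  rewrite -(mulgV (semi_aut p)) ring_autME -semi_comm.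
  by rewrite (mulrA s) sp mul1r.
exists (Semilin su sc); split; apply: semilinP => //=; first exact: mulVg.
exact: mulgV.
Qed.

Definition semi_inv (p : semilin) : semilin := sval (cid (semi_inv_subproof p)).

Fact semi_mulA : associative semi_mul.
Proof. by move=> p q r; apply: semilinP => /=; rewrite ?mulrA ?mulgA. Qed.
Fact semi_mul1l : left_id semi_one semi_mul.
Proof. by move=> p; apply: semilinP => /=; rewrite ?mul1r ?mul1g. Qed.
Fact semi_mul1r : right_id semi_one semi_mul.
Proof. by move=> p; apply: semilinP => /=; rewrite ?mulr1 ?mulg1. Qed.
Fact semi_mulV : left_inverse semi_one semi_inv semi_mul.
Proof. by move=> p; rewrite /semi_inv; case: cid => q []. Qed.
Fact semi_Vmul : right_inverse semi_one semi_inv semi_mul.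
Proof. by move=> p; rewrite /semi_inv; case: cid => q []. Qed.

HB.instance Definition _ := isGroup.Build semilin
  semi_mulA semi_mul1l semi_mul1r semi_mulV semi_Vmul.

Fact semi_aut_monoid_morphism : monoid.monoid_morphism semi_aut.
Proof. by []. Qed.

HB.instance Definition _ :=
  isUMagmaMorphism.Build semilin (ring_aut R) semi_aut
    semi_aut_monoid_morphism.

End Semilinearization.

Section SemiFunctor.
Variable R : pzRingType.

Section Map.
Variables (A B : RingUnder R) (h : mor A B).

Local Notation fA := (coslice_map A : {rmorphism R -> _}).
Local Notation fB := (coslice_map B : {rmorphism R -> _}).
Local Notation hmap :=
  (sval h : {rmorphism coslice_cod A -> coslice_cod B}).

Lemma hmap_under r : hmap (fA r) = fB r.
Proof. exact: (congr1 (fun u : {rmorphism R -> _} => u r) (svalP h)). Qed.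

Definition semi_map (p : semilin fA) : semilin fB.
Proof.
exists (hmap (semi_val p)) (semi_aut p).
- have [t [tp pt]] := semi_unit p.
  by exists (hmap t); rewrite -!rmorphM tp pt rmorph1.
- by move=> r; rewrite -!hmap_under -!rmorphM semi_comm.
Defined.

Fact semi_map_monoid_morphism : monoid.monoid_morphism semi_map.
Proof.
split=> [|p q]; apply: semilinP => //=; first exact: rmorph1.
exact: rmorphM.
Qed.

HB.instance Definition _ :=
  isUMagmaMorphism.Build (semilin fA) (semilin fB) semi_map
    semi_map_monoid_morphism.

End Map.

Definition semi_obj (A : RingUnder R) : GrpOver R :=
  @SliceObj Grp (ring_aut R : groupType) (semilin (coslice_map A) : groupType)
    (@semi_aut R (coslice_cod A) (coslice_map A) : {grphom _ -> _}).

Definition semi_hom (A B : RingUnder R) (h : mor A B) :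
  mor (semi_obj A) (semi_obj B).
Proof.
exists (semi_map h : {grphom _ -> _}).
exact: grphomP.
Defined.

Fact semi_hom1 (A : RingUnder R) : semi_hom (idc A) = idc (semi_obj A).
Proof.
by apply: slice_hom_eq; apply: grphomP => p; apply: semilinP.
Qed.

Fact semi_homM (A B D : RingUnder R) (v : mor B D) (u : mor A B) :
  semi_hom (compc v u) = compc (semi_hom v) (semi_hom u).
Proof.
by apply: slice_hom_eq; apply: grphomP => p; apply: semilinP.
Qed.

Definition semi : functor (RingUnder R) (GrpOver R) :=
  Functor semi_hom1 semi_homM.

End SemiFunctor.

(* Main.v *)
Require Import Defs.
From mathcomp Require Import all_boot all_order all_algebra.
From HB Require Import structures.
From mathcomp Require Import boolp finmap monalg.

(** The twisted group ring is generated by R and by one invertible element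
    u_g for each g in G, with u_g u_h = u_(gh) and u_g r = theta_g(r) u_g.
    These relations say exactly that g |-> (u_g, theta_g) is a group
    homomorphism from G to the semilinearization of the inclusion of R in
    R_theta[G], over Aut(R): this is the unit of the adjunction
    ([adj_unit]).  Transposition composes this unit with semi_R(h), so its
    naturality follows from functoriality of semi_R and naturality of the unit
    ([adj_unit_natural]).

    It remains to see that the unit is universal.  Let f : R -> S be a ring
    under R.  A homomorphism G -> semi_R(S) over Aut(R) is a family of units
    s_g of S, multiplicative in g, with s_g f(r) = f(theta_g(r)) s_g.  The
    additive map r g |-> f(r) s_g is then multiplicative, because
    f(r) s_g f(r') s_h = f(r theta_g(r')) s_(gh) ([tw_lift_monoid_morphism]).
    It is the only ring homomorphism under R sending u_g to s_g, because
    r g = r u_g ([tw_term_factor]). *)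

Set Implicit Arguments.
Unset Strict Implicit.
Unset Printing Implicit Defensive.

Import GRing.Theory.

Local Open Scope ring_scope.

(** * The group elements inside the twisted group ring *)

Section GroupElements.
Variables (R : pzRingType) (G : groupType) (theta : {grphom G -> ring_aut R}).

Local Notation twr := (twisted_ring theta).

Definition tw_basis (g : G) : twr := << 1 *g g >>.

Lemma tw_basis1 : tw_basis 1%g = 1.
Proof. by []. Qed.

Lemma tw_basisM g h : tw_basis (g * h)%g = tw_basis g * tw_basis h.
Proof. by rewrite [RHS]tw_mulU rmorph1 mulr1. Qed.

Lemma tw_term_factor r g : << r *g g >> = tw_incl theta r * tw_basis g.
Proof. by rewrite [RHS]tw_mulU rmorph1 mulr1 mul1g. Qed.

Lemma tw_basis_comm g r :
  tw_basis g * tw_incl theta r = tw_incl theta (theta g r) * tw_basis g.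
Proof. by rewrite -tw_term_factor [LHS]tw_mulU mul1r mulg1. Qed.

Lemma tw_basis_invertible g : invertible (tw_basis g).
Proof.
by exists (tw_basis g^-1%g); rewrite -!tw_basisM mulVg mulgV tw_basis1.
Qed.

Definition tw_semilin (g : G) : semilin (tw_incl theta) :=
  Semilin (tw_basis_invertible g) (tw_basis_comm g).

Fact tw_semilin_monoid_morphism : monoid.monoid_morphism tw_semilin.
Proof.
split=> [|g h]; apply: semilinP => //=; first exact: gmulf1.
- exact: tw_basisM.
- exact: gmulfM.
Qed.

HB.instance Definition _ :=
  isUMagmaMorphism.Build G (semilin (tw_incl theta)) tw_semilin
    tw_semilin_monoid_morphism.

End GroupElements.

(** * Ring homomorphisms out of the twisted group ring *)

Section Lift.
Variables (R : pzRingType) (G : groupType) (theta : {grphom G -> ring_aut R}).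
Variables (S : pzRingType) (f : {rmorphism R -> S}).
Variables (j : {grphom G -> semilin f}).
Hypothesis j_over : forall g, semi_aut (j g) = theta g.

Local Notation twr := (twisted_ring theta).

Definition lift_coef (g : G) (r : R) : S := f r * semi_val (j g).

Fact lift_coef_zmod_morphism g : zmod_morphism (lift_coef g).
Proof. by move=> r s; rewrite /lift_coef rmorphB mulrBl. Qed.

HB.instance Definition _ g :=
  GRing.isZmodMorphism.Build R S (lift_coef g) (lift_coef_zmod_morphism g).

(** The condition on j is an argument so that the multiplicativity that
    follows from it can be recorded as a structure on the map. *)
Definition tw_lift of (forall g, semi_aut (j g) = theta g) : twr -> S :=
  malg_ext (fun g => lift_coef g : {additive R -> S}).

Local Notation lift := (tw_lift j_over).

Fact tw_lift_zmod_morphism : zmod_morphism lift.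
Proof. exact: malg_ext_zmod_morphism. Qed.

HB.instance Definition _ :=
  GRing.isZmodMorphism.Build twr S lift tw_lift_zmod_morphism.

Lemma tw_liftU r g : lift << r *g g >> = f r * semi_val (j g).
Proof. exact: malg_extU. Qed.

(** By additivity it suffices to compare products of terms, where moving
    semi_val (j g) past f s applies theta g to s. *)
Fact tw_lift_monoid_morphism : GRing.monoid_morphism lift.
Proof.
split=> [|x y]; first by rewrite [LHS]tw_liftU rmorph1 mul1r gmulf1.
elim/tw_ind: x => [|x x' IHx IHx'|g r].
- by rewrite mul0r raddf0 mul0r.
- by rewrite mulrDl !raddfD /= IHx IHx' -mulrDl.
elim/tw_ind: y => [|y y' IHy IHy'|h s].
- by rewrite mulr0 raddf0 mulr0.
- by rewrite mulrDr !raddfD /= IHy IHy' -mulrDr.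
rewrite [X in lift X]tw_mulU !tw_liftU gmulfM /= rmorphM -j_over.
by rewrite -!mulrA; congr (_ * _); rewrite !mulrA semi_comm.
Qed.

HB.instance Definition _ :=
  GRing.isMonoidMorphism.Build twr S lift tw_lift_monoid_morphism.

Lemma tw_lift_incl r : lift (tw_incl theta r) = f r.
Proof. by rewrite [LHS]tw_liftU gmulf1 mulr1. Qed.

Lemma tw_lift_basis g : lift (tw_basis theta g) = semi_val (j g).
Proof. by rewrite [LHS]tw_liftU rmorph1 mul1r. Qed.

End Lift.

Lemma tw_rmorph_eq (R : pzRingType) (G : groupType)
    (theta : {grphom G -> ring_aut R}) (S : pzRingType)
    (u v : {rmorphism twisted_ring theta -> S}) :
    (forall r, u (tw_incl theta r) = v (tw_incl theta r)) ->
    (forall g, u (tw_basis theta g) = v (tw_basis theta g)) ->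
  u = v.
Proof.
move=> uvR uvG; apply: rmorphP => x.
elim/tw_ind: x => [|x y IHx IHy|g r]; first by rewrite !raddf0.
  by rewrite !raddfD /= IHx IHy.
by rewrite (tw_term_factor theta) !rmorphM uvR uvG.
Qed.

(** * The adjunction *)

Section Adjunction.
Variable R : pzRingType.

Definition adj_unit (A : GrpOver R) : mor A (semi R (twist R A)).
Proof.
exists (@tw_semilin R (slice_dom A) (slice_map A) : {grphom _ -> _}).
exact: grphomP.
Defined.

Lemma adj_unit_natural (A A' : GrpOver R) (a : mor A' A) :
  compc (adj_unit A) a =
  compc (fhom (semi R) (fhom (twist R) a)) (adj_unit A').
Proof.
apply: slice_hom_eq; apply: grphomP => g; apply: semilinP => /=.
  by rewrite [RHS]tw_mapU.
exact: tw_map_theta.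
Qed.

Definition transpose (A : GrpOver R) (B : RingUnder R)
    (h : mor (twist R A) B) : mor A (semi R B) :=
  compc (fhom (semi R) h) (adj_unit A).

Section Untranspose.
Variables (A : GrpOver R) (B : RingUnder R) (j : mor A (semi R B)).

Local Notation fB := (coslice_map B : {rmorphism R -> _}).
Local Notation jmap := (sval j : {grphom slice_dom A -> semilin fB}).

Lemma semi_aut_over g :
  semi_aut (jmap g) = (slice_map A : {grphom _ -> ring_aut R}) g.
Proof. by rewrite -[in RHS](svalP j). Qed.

Definition untranspose : mor (twist R A) B.
Proof.
exists (tw_lift semi_aut_over : {rmorphism _ -> _}).
apply: rmorphP => r; exact: tw_lift_incl.
Defined.

End Untranspose.

Lemma transposeK (A : GrpOver R) (B : RingUnder R) :
  cancel (@transpose A B) (@untranspose A B).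
Proof.
move=> h; apply: coslice_hom_eq; apply: tw_rmorph_eq => [r|g] /=.
  by rewrite tw_lift_incl -[LHS](hmap_under h).
by rewrite tw_lift_basis.
Qed.

Lemma untransposeK (A : GrpOver R) (B : RingUnder R) :
  cancel (@untranspose A B) (@transpose A B).
Proof.
move=> j; apply: slice_hom_eq; apply: grphomP => g; apply: semilinP => /=.
  exact: tw_lift_basis.
by rewrite semi_aut_over.
Qed.

Lemma transpose_natural (A A' : GrpOver R) (B B' : RingUnder R)
    (a : mor A' A) (b : mor B B') (h : mor (twist R A) B) :
  transpose (compc (compc b h) (fhom (twist R) a)) =
  compc (compc (fhom (semi R) b) (transpose h)) a.
Proof.
by rewrite /transpose !fhomM -!compcA adj_unit_natural.
Qed.

End Adjunction.

Theorem theorem1p1 (R : pzRingType) : left_adjoint (twist R) (semi R).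
Proof.
exists (@transpose R); split=> [A B|A A' B B' a b h].
  exact: Bijective (@transposeK R A B) (@untransposeK R A B).
exact: transpose_natural.
Qed.
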